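(* Let $\gamma=0$ and assume that the eigenvalues of $A$ can be anywhere in the interval $[0,\infty)$. Then the optimal relaxation parameter $\theta^\star_{\mathrm{ND}_3}$ of the Neumann-Dirichlet algorithm ND$_3$ is identical to the optimal relaxation parameter $\theta^\star_{\mathrm{DN}_2}$ of the Dirichlet-Neumann algorithm DN$_2$ (for the same $\nu$, $T$, $\alpha$).
   Context: Let $\nu>0$, $T>0$, $0<\alpha<T$, $\Omega_1=(0,\alpha)$, $\Omega_2=(\alpha,T)$. For an eigenvalue $d\ge 0$ write (S) for the system $\dot z+dz-\nu^{-1}\mu=0$, $\dot\mu-z-d\mu=0$. Take $\gamma=0$. Algorithm ND$_3$: given $f^0\in\mathbb{R}$, for $k\ge1$ solve (S) for $(z_1^k,\mu_1^k)$ in $\Omega_1$ with $z_1^k(0)=0$, $\dot\mu_1^k(\alpha)=f^{k-1}$; solve (S) for $(z_2^k,\mu_2^k)$ in $\Omega_2$ with $\mu_2^k(\alpha)=\mu_1^k(\alpha)$, $\mu_2^k(T)=0$; set $f^k=(1-\theta)f^{k-1}+\theta\dot\mu_2^k(\alpha)$. Algorithm DN$_2$: given $f^0\in\mathbb{R}$, for $k\ge1$ solve (S) for $(z_1^k,\mu_1^k)$ in $\Omega_1$ with $z_1^k(0)=0$, $z_1^k(\alpha)=f^{k-1}$; solve (S) for $(z_2^k,\mu_2^k)$ in $\Omega_2$ with $\dot z_2^k(\alpha)=\dot z_1^k(\alpha)$, $\mu_2^k(T)=0$; set $f^k=(1-\theta)f^{k-1}+\theta z_2^k(\alpha)$. For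 each algorithm, by linearity $f^k=r(\theta,d)f^{k-1}$ for a real number $r(\theta,d)$ (depending on the algorithm and on $\theta,d,\nu,T,\alpha$). The optimal relaxation parameter of the algorithm is the minimizer over $\theta\in(0,1)$ of $\sup_{d\in[0,\infty)}|r(\theta,d)|$. *)

(* Defs.v *)
(* Stdlib reals, with Coquelicot for suprema in the extended reals. *)
From Stdlib Require Import Reals.
From Coquelicot Require Import Coquelicot.
Open Scope R_scope.

(* [dz], [dmu] are the time derivatives of [z], [mu] on the closed interval
   [[a, b]]: two-sided inside and one-sided at the end points, which is what
   [D_in] relative to [[a, b]] means.  This gives a meaning to the transmission
   conditions on derivatives at the interface. *)
Definition solves_S (nu d a b : R) (z dz mu dmu : R -> R) : Prop :=
  forall t, a <= t <= b ->
    D_in z dz (fun s => a <= s <= b) t /\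
    D_in mu dmu (fun s => a <= s <= b) t /\
    dz t + d * z t - / nu * mu t = 0 /\
    dmu t - z t - d * mu t = 0.

(* [f] is f^(k-1) and [f'] is f^k. *)
Definition ND3_step (nu T alpha theta d f f' : R) : Prop :=
  exists z1 dz1 mu1 dmu1 z2 dz2 mu2 dmu2 : R -> R,
    (solves_S nu d 0 alpha z1 dz1 mu1 dmu1 /\
     z1 0 = 0 /\ dmu1 alpha = f) /\
    (solves_S nu d alpha T z2 dz2 mu2 dmu2 /\
     mu2 alpha = mu1 alpha /\ mu2 T = 0) /\
    f' = (1 - theta) * f + theta * dmu2 alpha.

Definition DN2_step (nu T alpha theta d f f' : R) : Prop :=
  exists z1 dz1 mu1 dmu1 z2 dz2 mu2 dmu2 : R -> R,
    (solves_S nu d 0 alpha z1 dz1 mu1 dmu1 /\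
     z1 0 = 0 /\ z1 alpha = f) /\
    (solves_S nu d alpha T z2 dz2 mu2 dmu2 /\
     dz2 alpha = dz1 alpha /\ mu2 T = 0) /\
    f' = (1 - theta) * f + theta * z2 alpha.

Definition iterates (step : R -> R -> Prop) (f : nat -> R) : Prop :=
  forall k : nat, step (f k) (f (S k)).

(* The first conjunct makes [rho] unique: without it, an algorithm that cannot
   be run would admit every number as its factor. *)
Definition is_convergence_factor (step : R -> R -> Prop) (rho : R) : Prop :=
  (forall f0 : R, exists f : nat -> R, f 0%nat = f0 /\ iterates step f) /\
  (forall f : nat -> R, iterates step f -> forall k : nat, f (S k) = rho * f k).

Definition worst_case (r : R -> R -> R) (theta : R) : Rbar :=
  Lub_Rbar (fun x => exists d : R, 0 <= d /\ x = Rabs (r theta d)).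

Definition is_optimal_relaxation (r : R -> R -> R) (theta : R) : Prop :=
  0 < theta < 1 /\
  forall theta', 0 < theta' < 1 -> Rbar_le (worst_case r theta) (worst_case r theta').

(* Main.v *)
(** The Wronskian [z1 * mu2 - z2 * mu1] of two solutions of (S) is constant,
    because the matrix of (S) has trace [0].  Comparing an arbitrary subdomain
    solution with the explicit hyperbolic one therefore fixes the ratio of its
    interface traces, and both factors take the form [1 - theta * (1 + X d)].
    With [sigma = sqrt (d^2 + 1/nu)] one finds
    [X d = coth (sigma q) * (sigma + d tanh (sigma p)) / (sigma tanh (sigma p) + d)]
    where [(p, q) = (alpha, T - alpha)] for ND3 and [(p, q) = (T - alpha, alpha)]
    for DN2.  In both cases [X] takes values in [[1, X 0]] and has infimum [1],
    so equioscillation between [1 - 2 theta] and [theta (1 + X 0) - 1] gives the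
    optimal parameter [2 / (3 + X 0)]; and [X 0] is symmetric in [p] and [q]. *)
Require Import Defs.
From Stdlib Require Import Reals Lra.
From Coquelicot Require Import Coquelicot.
Open Scope R_scope.

(** * Hyperbolic functions and bounds on the hyperbolic cotangent *)

Lemma sinh_pos (x : R) : 0 < x -> 0 < sinh x.
Proof. intros hx. rewrite <- sinh_0. now apply sinh_lt. Qed.

Lemma cosh_pos (x : R) : 0 < cosh x.
Proof. unfold cosh. pose proof (exp_pos x). pose proof (exp_pos (- x)). lra. Qed.

Lemma sinh_lt_cosh (x : R) : sinh x < cosh x.
Proof. unfold cosh, sinh. pose proof (exp_pos (- x)). lra. Qed.

Definition coth (x : R) : R := cosh x / sinh x.

Lemma coth_ge_1 (x : R) : 0 < x -> 1 <= coth x.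
Proof.
  intros hx. pose proof (sinh_pos x hx). pose proof (sinh_lt_cosh x).
  unfold coth. apply -> Rle_div_r; lra.
Qed.

(** After clearing denominators the difference is [sinh (y - x)], by the addition formula. *)
Lemma coth_antitone (x y : R) : 0 < x -> x <= y -> coth y <= coth x.
Proof.
  intros hx hxy.
  assert (hsx := sinh_pos x hx).
  assert (hsy : 0 < sinh y) by (apply sinh_pos; lra).
  assert (h : sinh y * cosh x - cosh y * sinh x = sinh (y - x)).
  { unfold sinh, cosh.
    replace (- (y - x)) with (x + - y) by ring.
    replace (y - x) with (y + - x) by ring.
    rewrite !exp_plus. field. }
  assert (0 <= sinh (y - x)).
  { destruct (Req_dec x y) as [-> | hne].
    - replace (y - y) with 0 by ring. rewrite sinh_0. lra.
    - apply Rlt_le, sinh_pos. lra. }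
  unfold coth. apply <- Rle_div_l; [|lra].
  replace (cosh x / sinh x * sinh y) with (cosh x * sinh y / sinh x) by (field; lra).
  apply -> Rle_div_r; lra.
Qed.

(** Equivalent to [x * exp (- x) <= sinh x], which follows from [exp (2 * x) >= 1 + 2 * x]. *)
Lemma coth_le (x : R) : 0 < x -> coth x <= 1 + / x.
Proof.
  intros hx. assert (hs := sinh_pos x hx).
  unfold coth. apply <- Rle_div_l; [|lra].
  assert (h : x * (cosh x - sinh x) <= sinh x).
  { unfold cosh, sinh.
    replace (x * ((exp x + exp (- x)) / 2 - (exp x - exp (- x)) / 2))
      with (x * exp (- x)) by field.
    assert (he : exp x = exp (- x) * exp (2 * x))
      by (rewrite <- exp_plus; f_equal; ring).
    rewrite he.
    pose proof (exp_ineq1_le (2 * x)). pose proof (exp_pos (- x)). nra. }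
  apply Rmult_le_reg_l with x; [lra|].
  replace (x * ((1 + / x) * sinh x)) with (x * sinh x + sinh x) by (field; lra).
  lra.
Qed.

(** * Derivatives relative to an interval and the Wronskian *)

Lemma D_in_restrict (f : R -> R) (l : R) (df : R -> R) (D : R -> Prop) (t : R) :
  is_derive f t l -> df t = l -> D_in f df D t.
Proof.
  intros h <-. apply is_derive_Reals in h.
  apply (D_in_imp f df no_cond); [now intros|].
  now apply derivable_pt_lim_D_in.
Qed.

Lemma null_D_in_endpoints (f : R -> R) (a b : R) :
  a < b ->
  (forall t, a <= t <= b -> D_in f (fun _ => 0) (fun s => a <= s <= b) t) ->
  f a = f b.
Proof.
  intros hab h.
  (* The mean value theorem needs two-sided continuity at the end points. *)
  pose (clamp := fun t => Rmax a (Rmin b t)).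
  assert (hid : forall t, a <= t <= b -> clamp t = t).
  { intros t ht. unfold clamp. rewrite Rmin_right by lra. apply Rmax_right; lra. }
  assert (hin : forall t, a <= clamp t <= b).
  { intros t. unfold clamp, Rmax, Rmin.
    repeat destruct Rle_dec; lra. }
  destruct (MVT_gen (fun t => f (clamp t)) a b (fun _ => 0)) as [c [_ hc]].
  - rewrite Rmin_left, Rmax_right by lra. intros t ht.
    apply is_derive_Reals. intros eps heps.
    destruct (h t ltac:(lra) eps heps) as [del [hdel hlim]].
    (* This radius keeps [t + k] inside the interval, where [clamp] is the identity. *)
    assert (hm : 0 < Rmin del (Rmin (t - a) (b - t)))
      by (repeat apply Rmin_pos; lra).
    exists (mkposreal _ hm). simpl. intros k hk hkm.
    assert (h1 := Rmin_l del (Rmin (t - a) (b - t))).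
    assert (h2 := Rmin_r del (Rmin (t - a) (b - t))).
    assert (h3 := Rmin_l (t - a) (b - t)).
    assert (h4 := Rmin_r (t - a) (b - t)).
    assert (hk' := Rabs_def2 k _ hkm).
    rewrite !hid by lra.
    specialize (hlim (t + k)). simpl in hlim. unfold Rdist, D_x in hlim.
    replace (t + k - t) with k in hlim by ring.
    apply hlim. repeat split; lra.
  - rewrite Rmin_left, Rmax_right by lra. intros t ht.
    assert (hcont := cont_deriv _ _ _ _ (h t ht)).
    intros eps heps. destruct (hcont eps heps) as [del [hdel hlim]].
    exists del. split; [exact hdel|]. simpl in *. unfold Rdist in *.
    intros x [_ hx]. rewrite (hid t ht).
    (* The relative limit excludes the point [t] itself, yet [clamp] may send [x] to it. Otherwise
       [clamp x] is no farther from [t] than [x] is. *)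
    destruct (Req_dec (clamp x) t) as [-> | hne].
    + rewrite Rminus_diag, Rabs_R0. lra.
    + apply hlim. split; [split; [apply hin | now apply not_eq_sym]|].
      apply Rabs_def2 in hx. unfold clamp, Rmax, Rmin in *.
      apply Rabs_def1; repeat destruct Rle_dec; lra.
  - rewrite !hid in hc by lra. lra.
Qed.

Lemma solves_S_wronskian (nu d a b : R) (z dz mu dmu w dw la dla : R -> R) :
  a < b ->
  solves_S nu d a b z dz mu dmu -> solves_S nu d a b w dw la dla ->
  z a * la a - w a * mu a = z b * la b - w b * mu b.
Proof.
  intros hab h1 h2.
  apply (null_D_in_endpoints (fun t => z t * la t - w t * mu t) a b hab).
  intros t ht.
  destruct (h1 t ht) as (hz & hmu & e1 & e2).
  destruct (h2 t ht) as (hw & hla & e3 & e4).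
  assert (H := Dminus _ _ _ _ _ _ (Dmult _ _ _ _ _ _ hz hla) (Dmult _ _ _ _ _ _ hw hmu)).
  unfold D_in in *.
  replace 0 with (dz t * la t + z t * dla t - (dw t * mu t + w t * dmu t)); [exact H|].
  replace (dz t) with (/ nu * mu t - d * z t) by lra.
  replace (dw t) with (/ nu * la t - d * w t) by lra.
  replace (dmu t) with (z t + d * mu t) by lra.
  replace (dla t) with (w t + d * la t) by lra.
  ring.
Qed.

(** * Explicit solutions of (S) and their interface traces *)

Definition sigma (nu d : R) : R := sqrt (d * d + / nu).

Lemma sigma_sqr (nu d : R) : 0 < nu -> sigma nu d * sigma nu d = d * d + / nu.
Proof.
  intros hnu. apply sqrt_sqrt.
  pose proof (Rinv_0_lt_compat nu hnu). nra.
Qed.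

Lemma sigma_pos (nu d : R) : 0 < nu -> 0 < sigma nu d.
Proof.
  intros hnu. apply sqrt_lt_R0.
  pose proof (Rinv_0_lt_compat nu hnu). nra.
Qed.

Lemma sigma_gt (nu d : R) : 0 < nu -> 0 <= d -> d < sigma nu d.
Proof.
  intros hnu hd. pose proof (sigma_sqr nu d hnu). pose proof (sigma_pos nu d hnu).
  pose proof (Rinv_0_lt_compat nu hnu). nra.
Qed.

Lemma sigma_0_le (nu d : R) : sigma nu 0 <= sigma nu d.
Proof. apply sqrt_le_1_alt. nra. Qed.

(** Chosen so that [z] vanishes at 0: [mu] is read off from the first equation, and the second
    reduces to the formula for the square of [sigma]. *)
Lemma solves_S_left (nu d a b c : R) : 0 < nu ->
  let s := sigma nu d in
  solves_S nu d a b
    (fun t => c * sinh (s * t))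
    (fun t => c * (s * cosh (s * t)))
    (fun t => c * (nu * (s * cosh (s * t) + d * sinh (s * t))))
    (fun t => c * (nu * (s * (s * sinh (s * t) + d * cosh (s * t))))).
Proof.
  intros hnu s t _.
  assert (hs : s * s = d * d + / nu) by now apply sigma_sqr.
  unfold sinh, cosh. repeat split.
  - eapply D_in_restrict; [auto_derive; [easy|reflexivity]|]. unfold sinh, cosh; field.
  - eapply D_in_restrict; [auto_derive; [easy|reflexivity]|]. field.
  - field. lra.
  - set (E := exp (s * t)). set (F := exp (- (s * t))).
    transitivity (c * (nu * (s * s) - 1 - nu * (d * d)) * ((E - F) / 2)); [field|].
    rewrite hs. field. lra.
Qed.

(** The counterpart with [mu] vanishing at [T]: here [z] is read off from the second equation. *)
Lemma solves_S_right (nu d a b T c : R) : 0 < nu ->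
  let s := sigma nu d in
  solves_S nu d a b
    (fun t => - c * (s * cosh (s * (T - t)) + d * sinh (s * (T - t))))
    (fun t => c * (s * (s * sinh (s * (T - t)) + d * cosh (s * (T - t)))))
    (fun t => c * sinh (s * (T - t)))
    (fun t => - c * (s * cosh (s * (T - t)))).
Proof.
  intros hnu s t _.
  assert (hs : s * s = d * d + / nu) by now apply sigma_sqr.
  unfold sinh, cosh. repeat split.
  - eapply D_in_restrict; [auto_derive; [easy|reflexivity]|].
    unfold Rminus; field.
  - eapply D_in_restrict; [auto_derive; [easy|reflexivity]|].
    unfold Rminus; field.
  - set (E := exp (s * (T - t))). set (F := exp (- (s * (T - t)))).
    transitivity (c * (s * s - d * d - / nu) * ((E - F) / 2)); [field; lra|].
    rewrite hs. field. lra.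
  - field.
Qed.

(** Both [z]-components vanish at 0, so the Wronskian with the explicit solution is zero at [alpha]
    too. This ties [mu alpha] to [z alpha], and (S) turns that into relations for the derivatives.
    The first one serves DN2, the second ND3. *)
Lemma left_traces (nu d alpha : R) (z dz mu dmu : R -> R) :
  0 < nu -> 0 < alpha ->
  solves_S nu d 0 alpha z dz mu dmu -> z 0 = 0 ->
  let s := sigma nu d in
  let C := cosh (s * alpha) in let S := sinh (s * alpha) in
  S * dz alpha = s * C * z alpha /\
  (s * C + d * S) * dmu alpha = s * (s * S + d * C) * mu alpha.
Proof.
  intros hnu ha h h0 s C S.
  assert (hs : s * s = d * d + / nu) by now apply sigma_sqr.
  assert (hw := solves_S_wronskian _ _ _ _ _ _ _ _ _ _ _ _ ha h
                  (solves_S_left nu d 0 alpha 1 hnu)).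
  cbv beta in hw. fold s in hw. rewrite Rmult_0_r, sinh_0, h0 in hw.
  fold C S in hw.
  destruct (h alpha ltac:(lra)) as (_ & _ & e1 & e2).
  replace (dz alpha) with (/ nu * mu alpha - d * z alpha) by lra.
  replace (dmu alpha) with (z alpha + d * mu alpha) by lra.
  assert (hw' : S * mu alpha = nu * ((s * C + d * S) * z alpha)) by lra.
  split.
  - transitivity (/ nu * (S * mu alpha) - d * S * z alpha); [ring|].
    rewrite hw'. field. lra.
  - transitivity (/ nu * (nu * ((s * C + d * S) * z alpha)) + d * (s * C + d * S) * mu alpha);
      [field; lra|].
    rewrite <- hw'.
    transitivity ((s * s * S + d * s * C) * mu alpha); [rewrite hs; ring|ring].
Qed.

(** Same argument from the end [T], where both [mu]-components vanish. Here the first relation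
    serves ND3, the second DN2. *)
Lemma right_traces (nu d alpha T : R) (z dz mu dmu : R -> R) :
  0 < nu -> alpha < T ->
  solves_S nu d alpha T z dz mu dmu -> mu T = 0 ->
  let s := sigma nu d in
  let C := cosh (s * (T - alpha)) in let S := sinh (s * (T - alpha)) in
  S * dmu alpha = - (s * C * mu alpha) /\
  (s * C + d * S) * dz alpha = - (s * (s * S + d * C) * z alpha).
Proof.
  intros hnu ha h hT s C S.
  assert (hs : s * s = d * d + / nu) by now apply sigma_sqr.
  assert (hw := solves_S_wronskian _ _ _ _ _ _ _ _ _ _ _ _ ha h
                  (solves_S_right nu d alpha T T 1 hnu)).
  cbv beta in hw. fold s in hw.
  rewrite Rminus_diag, Rmult_0_r, sinh_0, hT in hw.
  fold C S in hw.
  destruct (h alpha ltac:(lra)) as (_ & _ & e1 & e2).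
  replace (dz alpha) with (/ nu * mu alpha - d * z alpha) by lra.
  replace (dmu alpha) with (z alpha + d * mu alpha) by lra.
  assert (hw' : (s * C + d * S) * mu alpha = - (S * z alpha)) by lra.
  split.
  - lra.
  - transitivity (/ nu * ((s * C + d * S) * mu alpha) - d * (s * C + d * S) * z alpha); [ring|].
    rewrite hw'.
    transitivity (- ((s * s * S + d * s * C) * z alpha)); [rewrite hs; ring|ring].
Qed.

(** * Range of the transfer function *)

(** This is [X d], its fraction expanded by [cosh (s * p)]. The subdomain with the derivative
    condition at the interface has length [p], the one with the Dirichlet condition length [q]. *)
Definition transfer (nu p q d : R) : R :=
  let s := sigma nu d in
  coth (s * q) *
  ((s * cosh (s * p) + d * sinh (s * p)) / (s * sinh (s * p) + d * cosh (s * p))).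

Section Bounds.

Context (nu p q d : R) (hnu : 0 < nu) (hp : 0 < p) (hq : 0 < q) (hd : 0 <= d).

Let s := sigma nu d.

Lemma transfer_denominator_pos : 0 < s * sinh (s * p) + d * cosh (s * p).
Proof.
  assert (hs : 0 < s) by now apply sigma_pos.
  assert (hS : 0 < sinh (s * p)) by (apply sinh_pos; nra).
  pose proof (cosh_pos (s * p)). nra.
Qed.

(** Both factors are at least 1: in the fraction, numerator minus denominator is
    [(s - d) * (cosh (s * p) - sinh (s * p))]. *)
Lemma transfer_ge_1 : 1 <= transfer nu p q d.
Proof.
  assert (hs : 0 < s) by now apply sigma_pos.
  assert (hsd : d < s) by now apply sigma_gt.
  assert (hden := transfer_denominator_pos).
  assert (h1 : 1 <= coth (s * q)) by (apply coth_ge_1; nra).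
  assert (h2 : 1 <= (s * cosh (s * p) + d * sinh (s * p)) /
                    (s * sinh (s * p) + d * cosh (s * p))).
  { apply -> Rle_div_r; [|lra]. pose proof (sinh_lt_cosh (s * p)). nra. }
  unfold transfer. fold s. nra.
Qed.

(** Cross-multiplying the fraction against [coth (s * p)] leaves only that the square of [sinh] is
    at most that of [cosh]. *)
Lemma transfer_le_coth : transfer nu p q d <= coth (s * q) * coth (s * p).
Proof.
  assert (hs : 0 < s) by now apply sigma_pos.
  assert (hden := transfer_denominator_pos).
  assert (hS : 0 < sinh (s * p)) by (apply sinh_pos; nra).
  assert (h1 : 1 <= coth (s * q)) by (apply coth_ge_1; nra).
  unfold transfer. fold s. apply Rmult_le_compat_l; [lra|].
  unfold coth. apply <- Rle_div_l; [|lra].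
  replace (cosh (s * p) / sinh (s * p) * (s * sinh (s * p) + d * cosh (s * p)))
    with (cosh (s * p) * (s * sinh (s * p) + d * cosh (s * p)) / sinh (s * p))
    by (field; lra).
  apply -> Rle_div_r; [|lra].
  pose proof (sinh_lt_cosh (s * p)).
  assert (sinh (s * p) * sinh (s * p) <= cosh (s * p) * cosh (s * p)) by nra.
  nra.
Qed.

End Bounds.

Lemma transfer_0 (nu p q : R) : 0 < nu -> 0 < p ->
  transfer nu p q 0 = coth (sigma nu 0 * q) * coth (sigma nu 0 * p).
Proof.
  intros hnu hp. unfold transfer, coth at 3. f_equal.
  pose proof (sigma_pos nu 0 hnu).
  assert (0 < sinh (sigma nu 0 * p)) by (apply sinh_pos; nra).
  field. lra.
Qed.

(** Monotonicity of [transfer] itself is avoided: its upper bound by two [coth] factors is antitone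
    in [sigma], and it is attained at [d = 0], where [sigma] is least. *)
Lemma transfer_le_0 (nu p q d : R) : 0 < nu -> 0 < p -> 0 < q -> 0 <= d ->
  transfer nu p q d <= transfer nu p q 0.
Proof.
  intros hnu hp hq hd. rewrite transfer_0 by assumption.
  eapply Rle_trans; [now apply transfer_le_coth|].
  pose proof (sigma_pos nu 0 hnu). pose proof (sigma_0_le nu d).
  assert (0 < sigma nu 0 * p) by nra. assert (0 < sigma nu 0 * q) by nra.
  assert (1 <= coth (sigma nu d * q)) by (apply coth_ge_1; nra).
  assert (1 <= coth (sigma nu d * p)) by (apply coth_ge_1; nra).
  apply Rmult_le_compat; try lra; apply coth_antitone; nra.
Qed.

Lemma transfer_near_1 (nu p q eps : R) : 0 < nu -> 0 < p -> 0 < q -> 0 < eps ->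
  exists d, 0 <= d /\ transfer nu p q d <= 1 + eps.
Proof.
  intros hnu hp hq heps.
  (* [coth x <= 1 + 1/x] bounds [transfer] by [(1 + del)^2] with [del = min 1 (eps/3)]. *)
  set (del := Rmin 1 (eps / 3)).
  assert (hdel : 0 < del) by (apply Rmin_pos; lra).
  assert (hdel1 : del <= 1) by apply Rmin_l.
  assert (hdel2 : del <= eps / 3) by apply Rmin_r.
  assert (hm : 0 < del * Rmin p q) by (apply Rmult_lt_0_compat; [lra|now apply Rmin_pos]).
  (* Since [sigma nu d > d], this choice makes both arguments of [coth] at least [/ del]. *)
  exists (/ (del * Rmin p q)). set (d := / (del * Rmin p q)).
  assert (hd : 0 < d) by now apply Rinv_0_lt_compat.
  assert (hbound : forall x, Rmin p q <= x -> coth (sigma nu d * x) <= 1 + del).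
  { intros x hx.
    assert (hsd := sigma_gt nu d hnu (Rlt_le _ _ hd)).
    assert (hpq : 0 < Rmin p q) by now apply Rmin_pos.
    assert (hle : / del <= sigma nu d * x).
    { replace (/ del) with (d * Rmin p q) by (unfold d; field; lra).
      apply Rmult_le_compat; lra. }
    assert (0 < / del) by now apply Rinv_0_lt_compat.
    eapply Rle_trans; [apply coth_le; lra|].
    assert (/ (sigma nu d * x) <= / / del) by (apply Rinv_le_contravar; lra).
    rewrite Rinv_inv in *. lra. }
  split; [lra|].
  eapply Rle_trans; [apply transfer_le_coth; lra|].
  assert (h1 := hbound p (Rmin_l _ _)). assert (h2 := hbound q (Rmin_r _ _)).
  pose proof (sigma_pos nu d hnu).
  assert (1 <= coth (sigma nu d * q)) by (apply coth_ge_1; nra).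
  assert (1 <= coth (sigma nu d * p)) by (apply coth_ge_1; nra).
  (* As [del <= 1], the square is at most [1 + 3 * del], hence at most [1 + eps]. *)
  apply Rle_trans with ((1 + del) * (1 + del)); [apply Rmult_le_compat; lra|].
  nra.
Qed.

(** * Convergence factors of the two algorithms *)

Lemma is_convergence_factor_step (step : R -> R -> Prop) (rho : R) :
  (forall f, step f (rho * f)) -> (forall f f', step f f' -> f' = rho * f) ->
  is_convergence_factor step rho.
Proof.
  intros hex huniq. split.
  - intros f0. exists (fun k => rho ^ k * f0). split; [simpl; ring|].
    intros k. simpl. rewrite Rmult_assoc. apply hex.
  - intros f hf k. apply huniq, hf.
Qed.

Lemma ND3_factor (nu T alpha theta d : R) :
  0 < nu -> 0 < alpha < T -> 0 <= d ->
  is_convergence_factor (ND3_step nu T alpha theta d)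
    (1 - theta * (1 + transfer nu alpha (T - alpha) d)).
Proof.
  intros hnu ha hd.
  assert (hs := sigma_pos nu d hnu).
  assert (hden := transfer_denominator_pos nu alpha d hnu ltac:(lra) hd).
  assert (hq : 0 < sinh (sigma nu d * (T - alpha))) by (apply sinh_pos; nra).
  assert (hnum : 0 < sigma nu d * cosh (sigma nu d * alpha) + d * sinh (sigma nu d * alpha)).
  { assert (0 < sinh (sigma nu d * alpha)) by (apply sinh_pos; nra).
    pose proof (cosh_pos (sigma nu d * alpha)). nra. }
  unfold transfer, coth. cbv zeta.
  apply is_convergence_factor_step.
  - intros f.
    (* The amplitude [A] solves [dmu1 alpha = f]; then [B] solves [mu2 alpha = mu1 alpha]. *)
    pose (A := f / (nu * sigma nu d *
      (sigma nu d * sinh (sigma nu d * alpha) + d * cosh (sigma nu d * alpha)))).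
    pose (B := A * nu * (sigma nu d * cosh (sigma nu d * alpha) + d * sinh (sigma nu d * alpha))
               / sinh (sigma nu d * (T - alpha))).
    do 8 eexists. split; [split; [exact (solves_S_left nu d 0 alpha A hnu)|]|].
    2: split; [split; [exact (solves_S_right nu d alpha T T B hnu)|]|].
    + cbv beta. rewrite Rmult_0_r, sinh_0. split; [ring|]. unfold A. field. lra.
    + cbv beta. rewrite Rminus_diag, Rmult_0_r, sinh_0. split; [|ring].
      unfold B. field. lra.
    + cbv beta. unfold B, A. field. lra.
  - intros f f' (z1 & dz1 & mu1 & dmu1 & z2 & dz2 & mu2 & dmu2 &
                 (h1 & h10 & hf) & (h2 & hmu & h2T) & ->).
    destruct (left_traces nu d alpha z1 dz1 mu1 dmu1) as [_ e1]; try assumption; [lra|].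
    destruct (right_traces nu d alpha T z2 dz2 mu2 dmu2) as [e2 _]; try assumption; [lra|].
    rewrite hmu in e2. rewrite hf in e1.
    apply (Rmult_eq_reg_l (sinh (sigma nu d * (T - alpha)))); [|lra].
    rewrite Rmult_plus_distr_l.
    rewrite (Rmult_comm theta), <- (Rmult_assoc _ (dmu2 alpha)), e2.
    replace (mu1 alpha) with
      ((sigma nu d * cosh (sigma nu d * alpha) + d * sinh (sigma nu d * alpha)) * f /
       (sigma nu d * (sigma nu d * sinh (sigma nu d * alpha) + d * cosh (sigma nu d * alpha))))
      by (rewrite e1; field; lra).
    field. lra.
Qed.

Lemma DN2_factor (nu T alpha theta d : R) :
  0 < nu -> 0 < alpha < T -> 0 <= d ->
  is_convergence_factor (DN2_step nu T alpha theta d)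
    (1 - theta * (1 + transfer nu (T - alpha) alpha d)).
Proof.
  intros hnu ha hd.
  assert (hs := sigma_pos nu d hnu).
  assert (hden := transfer_denominator_pos nu (T - alpha) d hnu ltac:(lra) hd).
  assert (hq : 0 < sinh (sigma nu d * alpha)) by (apply sinh_pos; nra).
  unfold transfer, coth. cbv zeta.
  apply is_convergence_factor_step.
  - intros f.
    (* The amplitude [A] solves [z1 alpha = f]; then [B] solves [dz2 alpha = dz1 alpha], a common
       factor [sigma] cancelling. *)
    pose (A := f / sinh (sigma nu d * alpha)).
    pose (B := A * cosh (sigma nu d * alpha) /
      (sigma nu d * sinh (sigma nu d * (T - alpha)) + d * cosh (sigma nu d * (T - alpha)))).
    do 8 eexists. split; [split; [exact (solves_S_left nu d 0 alpha A hnu)|]|].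
    2: split; [split; [exact (solves_S_right nu d alpha T T B hnu)|]|].
    + cbv beta. rewrite Rmult_0_r, sinh_0. split; [ring|]. unfold A. field. lra.
    + cbv beta. rewrite Rminus_diag, Rmult_0_r, sinh_0. split; [|ring].
      unfold B. field. lra.
    + cbv beta. unfold B, A. field. lra.
  - intros f f' (z1 & dz1 & mu1 & dmu1 & z2 & dz2 & mu2 & dmu2 &
                 (h1 & h10 & hf) & (h2 & hdz & h2T) & ->).
    destruct (left_traces nu d alpha z1 dz1 mu1 dmu1) as [e1 _]; try assumption; [lra|].
    destruct (right_traces nu d alpha T z2 dz2 mu2 dmu2) as [_ e2]; try assumption; [lra|].
    rewrite hdz in e2. rewrite hf in e1.
    assert (e1' : dz1 alpha = sigma nu d * cosh (sigma nu d * alpha) * f / sinh (sigma nu d * alpha))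
      by (rewrite <- e1; field; lra).
    rewrite e1' in e2.
    (* Written so that the right-hand side of [e2] appears and can be traded for a multiple of
       [f]. *)
    replace (z2 alpha) with
      (- (- (sigma nu d * (sigma nu d * sinh (sigma nu d * (T - alpha)) +
                        d * cosh (sigma nu d * (T - alpha))) * z2 alpha)) /
       (sigma nu d * (sigma nu d * sinh (sigma nu d * (T - alpha)) +
                        d * cosh (sigma nu d * (T - alpha)))))
      by (field; lra).
    rewrite <- e2. field. lra.
Qed.

(** * Equioscillation and the optimal parameter *)

Lemma optimal_relaxation (X : R -> R) :
  (forall d, 0 <= d -> 1 <= X d <= X 0) ->
  (forall eps, 0 < eps -> exists d, 0 <= d /\ X d <= 1 + eps) ->
  unique (is_optimal_relaxation (fun theta d => 1 - theta * (1 + X d))) (2 / (3 + X 0)).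
Proof.
  intros hX hlim.
  set (r := fun theta d => 1 - theta * (1 + X d)).
  assert (hX0 := hX 0 (Rle_refl 0)).
  set (ts := 2 / (3 + X 0)).
  assert (ets : ts * (3 + X 0) = 2) by (unfold ts; field; lra).
  assert (hts : 0 < ts < 1) by nra.
  (* The first bound comes from [X d] approaching 1, hence the [eps]; the second from [d = 0]. *)
  assert (hlow : forall theta, 0 < theta < 1 ->
    Rbar_le (1 - 2 * theta) (worst_case r theta) /\
    Rbar_le (theta * (1 + X 0) - 1) (worst_case r theta)).
  { intros theta ht.
    destruct (Lub_Rbar_correct (fun x => exists d, 0 <= d /\ x = Rabs (r theta d)))
      as [hub _].
    fold (worst_case r theta) in hub.
    assert (hr : forall d, 0 <= d -> Rbar_le (Rabs (r theta d)) (worst_case r theta))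
      by (intros d hd; apply hub; now exists d).
    clear hub. assert (h0 := hr 0 (Rle_refl 0)).
    destruct (worst_case r theta) as [M | |]; simpl in *; try easy.
    split.
    - apply le_epsilon. intros eps heps. destruct (hlim eps heps) as [d [hd hXd]].
      assert (h := hr d hd). assert (h' := Rle_abs (r theta d)).
      unfold r in *. nra.
    - assert (h' := Rabs_maj2 (r theta 0)). unfold r in *. lra. }
  (* At [ts] the two lower bounds coincide, and [1 <= X d <= X 0] confines [r ts d] between
     [- (1 - 2 * ts)] and [1 - 2 * ts]. *)
  assert (hup : Rbar_le (worst_case r ts) (1 - 2 * ts)).
  { destruct (Lub_Rbar_correct (fun x => exists d, 0 <= d /\ x = Rabs (r ts d)))
      as [_ hleast].
    apply hleast. intros x [d [hd ->]]. simpl.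
    assert (hXd := hX d hd). apply Rabs_le. unfold r. nra. }
  split; [split; [exact hts|]|].
  - intros theta ht. eapply Rbar_le_trans; [exact hup|].
    destruct (hlow theta ht) as [h1 h2].
    destruct (Rle_dec theta ts) as [hle | hgt].
    + eapply Rbar_le_trans; [|exact h1]. simpl. lra.
    + eapply Rbar_le_trans; [|exact h2]. simpl. nra.
  (* Uniqueness: the decreasing bound forces [ts <= theta], the increasing one [theta <= ts]. *)
  - intros theta [ht hopt].
    assert (h : Rbar_le (worst_case r theta) (1 - 2 * ts))
      by (eapply Rbar_le_trans; [apply hopt, hts | exact hup]).
    destruct (hlow theta ht) as [h1 h2].
    assert (h1' := Rbar_le_trans _ _ _ h1 h). assert (h2' := Rbar_le_trans _ _ _ h2 h).
    simpl in h1', h2'. nra.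
Qed.

Lemma transfer_optimal_relaxation (nu p q : R) : 0 < nu -> 0 < p -> 0 < q ->
  unique (is_optimal_relaxation (fun theta d => 1 - theta * (1 + transfer nu p q d)))
    (2 / (3 + transfer nu p q 0)).
Proof.
  intros hnu hp hq. apply optimal_relaxation.
  - intros d hd. split; [now apply transfer_ge_1 | now apply transfer_le_0].
  - intros eps heps. now apply transfer_near_1.
Qed.

Theorem theorem12 (nu T alpha : R)
  (hnu : 0 < nu) (hT : 0 < T) (halpha : 0 < alpha < T) :
  exists rND3 rDN2 : R -> R -> R,
    (forall theta d, 0 < theta < 1 -> 0 <= d ->
       is_convergence_factor (ND3_step nu T alpha theta d) (rND3 theta d)) /\
    (forall theta d, 0 < theta < 1 -> 0 <= d ->
       is_convergence_factor (DN2_step nu T alpha theta d) (rDN2 theta d)) /\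
    exists thetaND3 thetaDN2 : R,
      unique (is_optimal_relaxation rND3) thetaND3 /\
      unique (is_optimal_relaxation rDN2) thetaDN2 /\
      thetaND3 = thetaDN2.
Proof.
  exists (fun theta d => 1 - theta * (1 + transfer nu alpha (T - alpha) d)).
  exists (fun theta d => 1 - theta * (1 + transfer nu (T - alpha) alpha d)).
  split; [intros theta d _ hd; now apply ND3_factor|].
  split; [intros theta d _ hd; now apply DN2_factor|].
  do 2 eexists.
  split; [apply transfer_optimal_relaxation; lra|].
  split; [apply transfer_optimal_relaxation; lra|].
  (* At [d = 0], exchanging the two lengths only swaps the [coth] factors. *)
  rewrite !transfer_0 by lra. now rewrite (Rmult_comm (coth _)).
Qed.
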